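(* Let $(M,L)$ be a polarized manifold and let $r\geq 1$ be an integer. Suppose that $L$ is effective and $r$-generated. Then the map $\varphi_{|rL|}$ associated to the complete linear system $|rL|$ is an embedding of $M\setminus \mathrm{Bs}|L|$.
   Context: A polarized manifold $(M,L)$ is a smooth projective (connected) variety $M$ over $\mathbb{C}$ together with an ample line bundle $L$ on $M$. The tensor powers of $L$ are written additively: $iL=L^{\otimes i}$. $L$ is effective if $H^0(M,L)\neq 0$. $\mathrm{Bs}|L|$ denotes the base locus of the complete linear system $|L|$, i.e. the set of points of $M$ at which all sections in $H^0(M,L)$ vanish. For an integer $r\ge 1$, $L$ is called $r$-generated if the graded algebra $G(M,L)=\bigoplus_{i\geq 1}H^0(M,iL)$ is generated by the sections of $H^0(M,L),\ldots,H^0(M,rL)$, i.e. every section of every $kL$ with $k\ge 1$ is a $\mathbb{C}$-linear combination of products of sections belonging to $H^0(M,iL)$ with $1\le i\le r$. *)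

(* Defs.v *)
(* Algebraic varieties over an algebraically closed field K in the classical
   language: subsets of projective space, Zariski topology, regular functions. *)
From HB Require Import structures.
From mathcomp Require Import all_boot all_order all_algebra.
From mathcomp Require Import boolp classical_sets reals complex mpoly.

Set Implicit Arguments.
Unset Strict Implicit.
Unset Printing Implicit Defensive.

Import GRing.Theory.

Local Open Scope classical_set_scope.
Local Open Scope ring_scope.

Section ProjectiveSpace.
Variable K : closedFieldType.

(* P^n(K), as the set of lines through the origin of K^(n+1). *)
Definition pspace (n : nat) := {D : {vspace 'rV[K]_n.+1} | \dim D == 1%N}.

(* A vector of homogeneous coordinates of x; everything below depends on this
   choice only up to a nonzero scalar. *)
Definition hcoord n (x : pspace n) : 'rV[K]_n.+1 := vpick (val x).

Lemma pspace_default_subproof n :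
  \dim <[const_mx 1 : 'rV[K]_n.+1]>%VS == 1%N.
Proof.
rewrite dim_vline; suff -> : (const_mx 1 : 'rV[K]_n.+1) != 0 by [].
by apply/eqP => /rowP/(_ ord0); rewrite !mxE => /eqP; rewrite oner_eq0.
Qed.

(* [v_0 : ... : v_n]; junk value if v = 0. *)
Definition proj_pt n (v : 'rV[K]_n.+1) : pspace n :=
  insubd (exist _ <[const_mx 1]>%VS (pspace_default_subproof n)) <[v]>%VS.

Definition hval n (f : {mpoly K[n.+1]}) (x : pspace n) : K :=
  f.@[fun i => hcoord x ord0 i].

Definition zclosed n (Z : set (pspace n)) : Prop :=
  exists S : set {mpoly K[n.+1]},
    (forall f, S f -> exists d : nat, f \is d.-homog) /\
    Z = [set x | forall f, S f -> hval f x = 0].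

Definition zopen n (W : set (pspace n)) : Prop := zclosed (~` W).

Definition locally_closed n (Y : set (pspace n)) : Prop :=
  exists Z W, [/\ zclosed Z, zopen W & Y = Z `&` W].

Definition irreducible_set n (X : set (pspace n)) : Prop :=
  X !=set0 /\
  forall A B, zclosed A -> zclosed B -> X `<=` A `|` B -> X `<=` A \/ X `<=` B.

Definition projective_variety n (X : set (pspace n)) : Prop :=
  zclosed X /\ irreducible_set X.

Definition irreducible_chain n (X : set (pspace n)) (d : nat)
    (Z : nat -> set (pspace n)) : Prop :=
  (forall i, (i <= d)%N -> [/\ zclosed (Z i), irreducible_set (Z i)
                             & Z i `<=` X]) /\
  (forall i, (i < d)%N -> Z i `<` Z i.+1).

(* Krull dimension of a closed set X. *)
Definition has_dim n (X : set (pspace n)) (d : nat) : Prop :=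
  (exists Z, irreducible_chain X d Z) /\
  (forall e Z, irreducible_chain X e Z -> (e <= d)%N).

(* T, of dimension d + 1, is the cone over the projective tangent space to X
   at x. *)
Definition smooth_at n (X : set (pspace n)) (d : nat) (x : pspace n) : Prop :=
  exists T : {vspace 'rV[K]_n.+1}, \dim T = d.+1 /\
    forall v : 'rV[K]_n.+1, v \in T <->
      forall (e : nat) (f : {mpoly K[n.+1]}),
        f \is e.-homog -> (forall y, X y -> hval f y = 0) ->
        \sum_(j < n.+1) hval f^`M(j) x * v ord0 j = 0.

Definition smooth n (X : set (pspace n)) : Prop :=
  exists d, has_dim X d /\ forall x, X x -> smooth_at X d x.

(* f is regular on U, an open subset of some locally closed set; only the
   values of f on U matter. *)
Definition regular_on n (U : set (pspace n)) (f : pspace n -> K) : Prop :=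
  forall x, U x -> exists W, [/\ zopen W, W x &
    exists (d : nat) (a b : {mpoly K[n.+1]}),
      [/\ a \is d.-homog, b \is d.-homog &
          forall y, U y -> W y -> hval b y != 0 /\ f y = hval a y / hval b y]].

(* Morphisms between locally closed sets: continuous maps pulling back regular
   functions to regular functions. *)
Definition morphism_on n m (X : set (pspace n)) (Y : set (pspace m))
    (f : pspace n -> pspace m) : Prop :=
  [/\ forall x, X x -> Y (f x),
      forall Z, zclosed Z ->
        exists2 Z', zclosed Z' & X `&` f @^-1` Z = X `&` Z'
    & forall V g, zopen V -> regular_on (Y `&` V) g ->
        regular_on (X `&` f @^-1` V) (g \o f)].

Definition isomorphism_on n m (X : set (pspace n)) (Y : set (pspace m))
    (f : pspace n -> pspace m) : Prop :=
  morphism_on X Y f /\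
  exists g, [/\ morphism_on Y X g, forall x, X x -> g (f x) = x
              & forall y, Y y -> f (g y) = y].

Definition embedding n m (X : set (pspace n)) (f : pspace n -> pspace m) :=
  locally_closed (f @` X) /\ isomorphism_on X (f @` X) f.

Definition closed_embedding n m (X : set (pspace n))
    (f : pspace n -> pspace m) :=
  zclosed (f @` X) /\ isomorphism_on X (f @` X) f.

(* A line bundle on X, given by an open cover together with a cocycle of
   transition functions. *)
Record line_bundle n (X : set (pspace n)) := LineBundle {
  lb_I : Type;
  lb_U : lb_I -> set (pspace n);
  lb_g : lb_I -> lb_I -> pspace n -> K;
  lb_open : forall i, exists2 W, zopen W & lb_U i = X `&` W;
  lb_cover : forall x, X x -> exists i, lb_U i x;
  lb_regular : forall i j, regular_on (lb_U i `&` lb_U j) (lb_g i j);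
  lb_neq0 : forall i j x, lb_U i x -> lb_U j x -> lb_g i j x != 0;
  lb_cocycle : forall i j k x, lb_U i x -> lb_U j x -> lb_U k x ->
    lb_g i j x * lb_g j k x = lb_g i k x
}.

Section LineBundles.
Variables (n : nat) (X : set (pspace n)).
Implicit Type L : line_bundle X.

Lemma lb_pow_regular_subproof L (k : nat) i j :
  regular_on (lb_U i `&` lb_U j) (fun x => lb_g (l := L) i j x ^+ k).
Proof.
move=> x Ux; have [W [oW Wx [d [a [b [ha hb hab]]]]]] := lb_regular Ux.
exists W; split=> //; exists (d * k)%N, (a ^+ k), (b ^+ k).
split; [exact: dhomogMn | exact: dhomogMn |] => y Uy Wy.
have [b0 ->] := hab y Uy Wy.
by rewrite /hval !rmorphXn /= expf_neq0 // expr_div_n.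
Qed.

Lemma lb_pow_neq0_subproof L (k : nat) i j x : lb_U i x -> lb_U j x ->
  lb_g (l := L) i j x ^+ k != 0.
Proof. by move=> Ui Uj; apply: expf_neq0; exact: lb_neq0. Qed.

Lemma lb_pow_cocycle_subproof L (m : nat) i j k x :
  lb_U i x -> lb_U j x -> lb_U k x ->
  lb_g (l := L) i j x ^+ m * lb_g j k x ^+ m = lb_g i k x ^+ m.
Proof. by move=> Ui Uj Uk; rewrite -exprMn lb_cocycle. Qed.

(* The tensor power kL. *)
Definition lb_pow L (k : nat) : line_bundle X :=
  @LineBundle n X (lb_I L) (@lb_U _ _ L) (fun i j x => lb_g (l := L) i j x ^+ k)
    (@lb_open _ _ L) (@lb_cover _ _ L) (@lb_pow_regular_subproof L k)
    (@lb_pow_neq0_subproof L k) (@lb_pow_cocycle_subproof L k).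

(* A section is given by its expressions s i in the trivializations over the
   sets lb_U i; the values of s i outside lb_U i are irrelevant. *)
Definition lsec L := lb_I L -> pspace n -> K.

Definition lsec_eq L (s t : lsec L) : Prop :=
  forall i x, lb_U i x -> s i x = t i x.

Definition H0 L : set (lsec L) := [set s : lsec L |
  (forall i, regular_on (lb_U i) (s i)) /\
  (forall i j x, lb_U i x -> lb_U j x -> s i x = lb_g i j x * s j x)].
Arguments H0 L _ : clear implicits.

Definition effective L : Prop :=
  exists2 s, H0 L s & ~ lsec_eq s (fun _ _ => 0).

Definition base_locus L : set (pspace n) :=
  [set x | X x /\ forall s, H0 L s -> forall i, lb_U i x -> s i x = 0].

Definition lsec_basis L (m : nat) (s : 'I_m -> lsec L) : Prop :=
  [/\ forall j, H0 L (s j),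
      forall c : 'I_m -> K,
        lsec_eq (L := L) (fun i x => \sum_j c j * s j i x) (fun _ _ => 0) ->
        forall j, c j = 0
    & forall t, H0 L t -> exists c : 'I_m -> K,
        lsec_eq t (fun i x => \sum_j c j * s j i x)].

(* x |-> [s_0(x) : ... : s_N(x)], computed in any trivialization around x; junk
   values outside X and at the common zeros of the s_j. *)
Definition lsec_map L (N : nat) (s : 'I_N.+1 -> lsec L) (x : pspace n) :
    pspace N :=
  match pselect (exists i : lb_I L, lb_U i x) with
  | left e => proj_pt (\row_j s j (sval (cid e)) x)
  | right _ => proj_pt 0
  end.

Definition no_common_zero L (N : nat) (s : 'I_N.+1 -> lsec L)
    (U : set (pspace n)) : Prop :=
  forall x i, U x -> lb_U i x -> exists j, s j i x != 0.

Definition very_ample L : Prop :=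
  exists (N : nat) (s : 'I_N.+1 -> lsec L),
    [/\ forall j, H0 L (s j), no_common_zero s X
      & closed_embedding X (lsec_map s)].

Definition ample L : Prop := exists2 k : nat, (0 < k)%N & very_ample (lb_pow L k).

Definition polarized_manifold L : Prop :=
  [/\ projective_variety X, smooth X & ample L].

(* Every section t of kL, k >= 1, is a finite sum over a < m of
   c_a * prod_(b < e a) u_(a,b), where u_(a,b) is a section of (d a b)L,
   1 <= d a b <= r, and each product has total degree k. *)
Definition r_generated (r : nat) L : Prop :=
  forall (k : nat) (t : lsec (lb_pow L k)), (0 < k)%N -> H0 (lb_pow L k) t ->
  exists (m : nat) (c : 'I_m -> K) (e : 'I_m -> nat) (d : 'I_m -> nat -> nat)
         (u : forall (a : 'I_m) (b : nat), lsec (lb_pow L (d a b))),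
    [/\ forall a b, (b < e a)%N ->
          (1 <= d a b <= r)%N /\ H0 (lb_pow L (d a b)) (u a b),
        forall a, (\sum_(b < e a) d a b)%N = k
      & lsec_eq t (fun i x => \sum_(a < m) c a * \prod_(b < e a) u a b i x)].

(* The map given by the s_j is defined on U and embeds it in P^N. *)
Definition lsec_map_embeds L (N : nat) (s : 'I_N.+1 -> lsec L)
    (U : set (pspace n)) : Prop :=
  no_common_zero s U /\ embedding U (lsec_map s).

End LineBundles.
End ProjectiveSpace.

Arguments H0 {K n X} L _.

(* Main.v *)
(* Let kL be very ample and let x be a point where a section t of L does not
   vanish. Since L is r-generated, every section v of kL, multiplied by
   t^((r-1)k), is a form of degree k in the sections of rL. Hence on {t <> 0} the
   closed embedding by kL is the composition of the map of |rL| with a map given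
   by forms, and a local inverse of the map of |rL| is obtained by following these
   forms with the inverse of the closed embedding. The locus {t <> 0} is the
   preimage of the complement of a hyperplane, because t^r is a section of rL;
   this makes the argument global on the target. *)
Require Import Defs.
From HB Require Import structures.
From mathcomp Require Import all_boot all_order all_algebra.
From mathcomp Require Import boolp classical_sets reals complex mpoly.

Set Implicit Arguments.
Unset Strict Implicit.
Unset Printing Implicit Defensive.

Import GRing.Theory.

Local Open Scope classical_set_scope.
Local Open Scope ring_scope.

(** * Forms evaluated on homogeneous coordinates *)

Section Homogeneous.
Variable K : closedFieldType.

(** Kept as a vector and not as a point, because [proj_pt] is junk at the common zeros of the
    [F j]. *)
Definition rval n m (F : 'I_m -> {mpoly K[n]}) (v : 'rV[K]_n) : 'rV[K]_m :=
  \row_j (F j).@[v ord0].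

Definition comp_forms n m (F : 'I_m -> {mpoly K[n]}) (f : {mpoly K[m]}) :
    {mpoly K[n]} := f \mPo [tuple F j | j < m].

Lemma meval_comp_forms n m (F : 'I_m -> {mpoly K[n]}) f (v : 'rV[K]_n) :
  (comp_forms F f).@[v ord0] = f.@[rval F v ord0].
Proof.
rewrite comp_mpoly_meval; apply: meval_eq => j.
by rewrite tnth_mktuple mxE.
Qed.

Lemma rval_comp n m p (F : 'I_m -> {mpoly K[n]}) (G : 'I_p -> {mpoly K[m]}) v :
  rval (fun j => comp_forms F (G j)) v = rval G (rval F v).
Proof. by apply/rowP => j; rewrite !mxE meval_comp_forms. Qed.

Lemma dhomog_prod_const n (I : Type) (l : seq I) (P : pred I)
    (f : I -> {mpoly K[n]}) (d : I -> nat) :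
  (forall i, P i -> f i \is (d i).-homog) ->
  \prod_(i <- l | P i) f i \is (\sum_(i <- l | P i) d i)%N.-homog.
Proof.
move=> h; apply: (big_ind2 (fun (p : {mpoly K[n]}) e => p \is e.-homog)) => //.
- exact: dhomog1.
- by move=> p1 e1 p2 e2 h1 h2; apply: dhomogM.
Qed.

Lemma dhomog_comp_forms n m (F : 'I_m -> {mpoly K[n]}) f d e :
  f \is d.-homog -> (forall j, F j \is e.-homog) ->
  comp_forms F f \is (d * e)%N.-homog.
Proof.
move=> hf hF; rewrite /comp_forms comp_mpolyEX big_seq rpred_sum // => mm Hm.
apply: dhomogZ; rewrite comp_mpolyX.
have <- : (\sum_(i < m) e * mm i = d * e)%N.
  have Em : mdeg mm = d := dhomog_mf hf Hm.
  by rewrite -big_distrr /= -mdegE Em mulnC.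
by apply: dhomog_prod_const => i _; rewrite tnth_mktuple; apply: dhomogMn.
Qed.

Lemma meval_dhomog_scale n (f : {mpoly K[n]}) d c (v : 'rV[K]_n) :
  f \is d.-homog -> f.@[(c *: v) ord0] = c ^+ d * f.@[v ord0].
Proof.
move=> hf; rewrite !mevalE mulr_sumr [LHS]big_seq [RHS]big_seq.
apply: eq_bigr => mm Hm.
rewrite mulrCA; congr (_ * _).
have <- : mdeg mm = d := dhomog_mf hf Hm.
rewrite mdegE -prodrXr -big_split /=.
by apply: eq_bigr => i _; rewrite mxE exprMn.
Qed.

Lemma rval_scale n m (F : 'I_m -> {mpoly K[n]}) d c (v : 'rV[K]_n) :
  (forall j, F j \is d.-homog) -> rval F (c *: v) = c ^+ d *: rval F v.
Proof. by move=> hF; apply/rowP => j; rewrite !mxE (meval_dhomog_scale _ _ (hF j)). Qed.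

Lemma hcoord_neq0 n (x : pspace K n) : hcoord x != 0.
Proof.
rewrite /hcoord vpick0 -dimv_eq0.
by case: x => /= D /eqP ->.
Qed.

Lemma proj_pt_hcoord n (x : pspace K n) : proj_pt (hcoord x) = x.
Proof.
apply: val_inj; rewrite /proj_pt insubdK.
  apply/eqP; rewrite eqEdim -memvE memv_pick /= dim_vline hcoord_neq0.
  by case: x => /= D /eqP ->.
by rewrite unfold_in dim_vline hcoord_neq0.
Qed.

Lemma proj_pt_scale n c (v : 'rV[K]_n.+1) : c != 0 -> proj_pt (c *: v) = proj_pt v.
Proof.
move=> c0; rewrite /proj_pt; congr insubd; apply/eqP; rewrite eqEdim.
rewrite !dim_vline scaler_eq0 (negPf c0) /= leqnn andbT -memvE.
by apply/vlineP; exists c.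
Qed.

Lemma hcoord_proj_pt n (v : 'rV[K]_n.+1) :
  v != 0 -> exists2 c, c != 0 & hcoord (proj_pt v) = c *: v.
Proof.
move=> v0.
have E : val (proj_pt v) = <[v]>%VS.
  by rewrite /proj_pt insubdK // unfold_in dim_vline v0.
have /vlineP[c Ec] : hcoord (proj_pt v) \in <[v]>%VS.
  by rewrite /hcoord -E memv_pick.
exists c => //; apply/eqP => c0.
by have := hcoord_neq0 (proj_pt v); rewrite Ec c0 scale0r eqxx.
Qed.

Lemma proj_pt_eq n (v w : 'rV[K]_n.+1) : v != 0 -> w != 0 ->
  proj_pt v = proj_pt w -> exists2 c, c != 0 & v = c *: w.
Proof.
move=> v0 w0 E; have [c c0 Ec] := hcoord_proj_pt v0.
have [d d0 Ed] := hcoord_proj_pt w0.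
exists (c^-1 * d); first by rewrite mulf_neq0 ?invr_neq0.
by rewrite -scalerA -Ed -E Ec scalerA mulVf // scale1r.
Qed.

Lemma row_neq0P n (v : 'rV[K]_n) : reflect (exists j, v ord0 j != 0) (v != 0).
Proof.
apply: (iffP idP) => [v0|[j vj]]; last by apply: contra_neq vj => ->; rewrite mxE.
apply: contrapT => H; move/eqP: v0; apply; apply/rowP => j; rewrite mxE.
by apply/eqP; apply: contrapT => vj; apply: H; exists j; apply/negP.
Qed.

(** The chosen coordinates of [proj_pt v] are a nonzero multiple c of [v], which changes the value
    of [f] by the factor c^d only. *)
Lemma hval_proj_pt0 n (f : {mpoly K[n.+1]}) d (v : 'rV[K]_n.+1) :
  f \is d.-homog -> v != 0 -> (hval f (proj_pt v) == 0) = (f.@[v ord0] == 0).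
Proof.
move=> hf v0; rewrite /hval; have [c c0 ->] := hcoord_proj_pt v0.
by rewrite (meval_dhomog_scale _ _ hf) mulf_eq0 expf_eq0 (negPf c0) andbF.
Qed.

End Homogeneous.

(** * Closed, open and locally closed sets *)

Section Zariski.
Variable K : closedFieldType.

(** Taking as equations all forms that vanish on some [Z i] avoids a choice of equations for each
    index. *)
Lemma zclosed_bigcap n (I : Type) (P : set I) (Z : I -> set (pspace K n)) :
  (forall i, P i -> zclosed (Z i)) -> zclosed (\bigcap_(i in P) Z i).
Proof.
move=> cZ.
exists [set f | (exists d, f \is d.-homog) /\
  exists2 i, P i & forall x, Z i x -> hval f x = 0]; split; first by move=> f [].
apply/seteqP; split => x /= H.
  by move=> f [_ [i Pi]]; apply; apply: H.
move=> i Pi; have [S [hS E]] := cZ i Pi; rewrite E => f Sf; apply: H.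
by split; [exact: hS|exists i => // y; rewrite E; apply].
Qed.

Lemma zclosedU n (A B : set (pspace K n)) :
  zclosed A -> zclosed B -> zclosed (A `|` B).
Proof.
move=> [S [hS ->]] [T [hT ->]].
exists [set h | exists f g, [/\ S f, T g & h = f * g]]; split.
  move=> _ [f [g [Sf Tg ->]]]; have [d hd] := hS f Sf; have [e he] := hT g Tg.
  by exists (d + e)%N; apply: dhomogM.
apply/seteqP; split => x /=.
  move=> H _ [f [g [Sf Tg ->]]]; rewrite /hval mevalM.
  by case: H; [move/(_ f Sf)|move/(_ g Tg)]; rewrite /hval => ->; rewrite ?mul0r ?mulr0.
move=> H; apply: contrapT => /not_orP[] /existsNP[f] /not_implyP[Sf /eqP f0].
move=> /existsNP[g] /not_implyP[Tg /eqP g0].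
have /eqP := H (f * g) (ex_intro _ f (ex_intro _ g (And3 Sf Tg erefl))).
rewrite /hval mevalM mulf_eq0 => /orP[] /eqP; exact/eqP.
Qed.

Lemma zclosedI n (A B : set (pspace K n)) :
  zclosed A -> zclosed B -> zclosed (A `&` B).
Proof.
move=> cA cB.
have -> : A `&` B = \bigcap_(b in setT) (if b then A else B).
  apply/seteqP; split=> x; first by move=> [? ?] [].
  by move=> H; split; [exact: (H true)|exact: (H false)].
by apply: zclosed_bigcap => -[].
Qed.

Lemma zclosed_hyper n (f : {mpoly K[n.+1]}) d :
  f \is d.-homog -> zclosed [set x | hval f x = 0].
Proof.
move=> hf; exists [set f]; split; first by move=> _ ->; exists d.
by apply/seteqP; split => x /=; [move=> H _ ->|apply].
Qed.

Lemma zopenI n (V W : set (pspace K n)) : zopen V -> zopen W -> zopen (V `&` W).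
Proof. by rewrite /zopen setCI; exact: zclosedU. Qed.

Lemma zopen_bigcup n (I : Type) (P : set I) (W : I -> set (pspace K n)) :
  (forall i, P i -> zopen (W i)) -> zopen (\bigcup_(i in P) W i).
Proof. by move=> oW; rewrite /zopen setC_bigcup; exact: zclosed_bigcap. Qed.

Lemma zopen_forall_ord n m (W : 'I_m -> set (pspace K n)) :
  (forall i, zopen (W i)) -> zopen [set x | forall i, W i x].
Proof.
move=> oW; pose V := \big[setI/setT]_(i < m) W i.
have -> : [set x | forall i, W i x] = V.
  apply/seteqP; split => x /=; rewrite /V -bigcap_seq => H i; first by move=> _.
  exact: (H i (mem_index_enum i)).
apply: (big_ind (@zopen K n)); [|exact: zopenI|by move=> i _; exact: oW].
(* The empty intersection is the whole space; its complement is cut out by the constant 1. *)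
rewrite /zopen setCT; exists [set 1]; split.
  by move=> _ ->; exists 0%N; exact: dhomog1.
apply/seteqP; split => x //= /(_ _ erefl); rewrite /hval rmorph1.
by move/eqP; rewrite oner_eq0.
Qed.

Lemma zopen_nz n (f : {mpoly K[n.+1]}) d :
  f \is d.-homog -> zopen [set x | hval f x != 0].
Proof.
move=> hf; rewrite /zopen.
have -> : ~` [set x | hval f x != 0] = [set x | hval f x = 0].
  apply/seteqP; split => x /=; first by move/negP/negPn/eqP.
  by move=> -> /eqP.
exact: zclosed_hyper hf.
Qed.

(** The common zeros of the [F j] have to be added to the preimage of [Z]. The products of some
    [F j] with an equation of [Z] pulled back along [F] cut out exactly this union. *)
Lemma zclosed_comp n m (F : 'I_m.+1 -> {mpoly K[n.+1]}) e (Z : set (pspace K m)) :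
  (forall j, F j \is e.-homog) -> zclosed Z ->
  zclosed [set x | rval F (hcoord x) = 0 \/ Z (proj_pt (rval F (hcoord x)))].
Proof.
move=> hF [S [hS ->]].
exists [set h | exists f j, S f /\ h = F j * comp_forms F f]; split.
  move=> _ [f [j [Sf ->]]]; have [d hd] := hS f Sf.
  by exists (e + d * e)%N; apply: dhomogM => //; apply: dhomog_comp_forms.
apply/seteqP; split => x /=.
  move=> H _ [f [j [Sf ->]]]; rewrite /hval mevalM meval_comp_forms.
  case: H => [/rowP/(_ j)|H]; first by rewrite !mxE => ->; rewrite mul0r.
  have [/rowP/(_ j)|v0] := eqVneq (rval F (hcoord x)) 0.
    by rewrite !mxE => ->; rewrite mul0r.
  have [d hd] := hS f Sf.
  by apply/eqP; rewrite mulf_eq0 -(hval_proj_pt0 hd v0) H // eqxx orbT.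
move=> H; have [|v0] := eqVneq (rval F (hcoord x)) 0; [by left|right].
move=> f Sf; have [d hd] := hS f Sf; apply/eqP; rewrite (hval_proj_pt0 hd v0).
have /row_neq0P[j] := v0; rewrite mxE => vj.
have /eqP := H _ (ex_intro _ f (ex_intro _ j (conj Sf erefl))).
by rewrite /hval mevalM meval_comp_forms mulf_eq0 (negPf vj).
Qed.

Lemma zopen_comp n m (F : 'I_m.+1 -> {mpoly K[n.+1]}) e (W : set (pspace K m)) :
  (forall j, F j \is e.-homog) -> zopen W ->
  zopen [set x | rval F (hcoord x) != 0 /\ W (proj_pt (rval F (hcoord x)))].
Proof.
move=> hF oW; rewrite /zopen.
have -> : ~` [set x | rval F (hcoord x) != 0 /\ W (proj_pt (rval F (hcoord x)))]
  = [set x | rval F (hcoord x) = 0 \/ (~` W) (proj_pt (rval F (hcoord x)))].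
  apply/seteqP; split => x /=.
    by move/not_andP => [/negP/negPn/eqP|]; [left|right].
  by case=> [->|nW] [] => [/eqP|].
exact: zclosed_comp hF oW.
Qed.

Lemma zopen_rval n m (F : 'I_m -> {mpoly K[n.+1]}) d :
  (forall j, F j \is d.-homog) -> zopen [set x | rval F (hcoord x) != 0].
Proof.
move=> hF.
have -> : [set x | rval F (hcoord x) != 0] =
    \bigcup_(j in setT) [set x | hval (F j) x != 0].
  apply/seteqP; split => x /=.
    by move=> /row_neq0P[j]; rewrite mxE => Fj; exists j.
  by case=> j _ Fj; apply/row_neq0P; exists j; rewrite mxE.
by apply: zopen_bigcup => j _; exact: zopen_nz (hF j).
Qed.

(* Y is the intersection of its closure with the union of the sets W. *)
Lemma locally_closed_local n (Y : set (pspace K n)) :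
  (forall y, Y y -> exists Z W, [/\ zclosed Z, zopen W, W y &
    Z `&` W `<=` Y /\ Y `&` W `<=` Z]) -> locally_closed Y.
Proof.
move=> loc.
pose P := [set ZW : set (pspace K n) * set (pspace K n) | [/\ zclosed ZW.1,
  zopen ZW.2, ZW.1 `&` ZW.2 `<=` Y & Y `&` ZW.2 `<=` ZW.1]].
exists (\bigcap_(Z in [set Z | zclosed Z /\ Y `<=` Z]) Z).
exists (\bigcup_(ZW in P) ZW.2); split.
- by apply: zclosed_bigcap => Z [].
- by apply: zopen_bigcup => ZW [].
apply/seteqP; split => y.
  move=> Yy; split; first by move=> Z [_]; apply.
  have [Z [W [cZ oW Wy [h1 h2]]]] := loc y Yy.
  by exists (Z, W).
move=> [H [[Z W] [/= cZ oW h1 h2] Wy]].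
(* This closed set contains [Y], hence y; as y lies in [W], it lies in [Z]. *)
have := H (Z `|` ~` W) (conj (zclosedU cZ oW) _).
case; last by []; last by move=> Zy; apply: h1.
move=> x Yx; have [Wx|] := pselect (W x); [left|by right].
exact: h2.
Qed.

End Zariski.

(** * Morphisms as maps given locally by forms of equal degree *)

Section Morphisms.
Variable K : closedFieldType.

(** For maps from [X] into [Y] this is equivalent to [morphism_on X Y], by [morphism_locally_forms]
    and [locally_forms_morphism]; in this shape, composition is substitution of polynomials. *)
Definition locally_given_by_forms n m (X : set (pspace K n))
    (f : pspace K n -> pspace K m) : Prop :=
  forall x, X x -> exists W (F : 'I_m.+1 -> {mpoly K[n.+1]}) d,
  [/\ zopen W, W x, forall j, F j \is d.-homog &
    forall y, X y -> W y ->
      rval F (hcoord y) != 0 /\ f y = proj_pt (rval F (hcoord y))].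

(** The fractions a_j / b_j are brought to the denominator given by the product of all b_l, on the
    intersection of their finitely many neighbourhoods. *)
Lemma regular_common_denominator n (U : set (pspace K n)) m
    (f : 'I_m -> pspace K n -> K) x :
  (forall j, regular_on U (f j)) -> U x ->
  exists W (a : 'I_m -> {mpoly K[n.+1]}) b d,
  [/\ zopen W, W x, forall j, a j \is d.-homog, b \is d.-homog &
    forall y, U y -> W y ->
      hval b y != 0 /\ forall j, hval (a j) y = hval b y * f j y].
Proof.
move=> hf Ux.
have /choice[T hT] : forall j, exists T : set (pspace K n) * nat *
    {mpoly K[n.+1]} * {mpoly K[n.+1]}, [/\ zopen T.1.1.1, T.1.1.1 x,
    T.1.2 \is (T.1.1.2).-homog, T.2 \is (T.1.1.2).-homog &
    forall y, U y -> T.1.1.1 y ->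
      hval T.2 y != 0 /\ f j y = hval T.1.2 y / hval T.2 y].
  move=> j; have [W [oW Wx [d [a [b [ha hb hab]]]]]] := hf j x Ux.
  by exists (W, d, a, b).
pose W j := (T j).1.1.1; pose d j := (T j).1.1.2.
pose a j := (T j).1.2; pose b j := (T j).2.
exists [set y | forall j, W j y], (fun j => a j * \prod_(l < m | l != j) b l),
  (\prod_(l < m) b l), (\sum_(l < m) d l)%N; split.
- by apply: zopen_forall_ord => j; case: (hT j).
- by move=> j; case: (hT j).
- move=> j; rewrite [(\sum_l d l)%N](bigD1 j) //=; apply: dhomogM; first by case: (hT j).
  by apply: dhomog_prod_const => l _; case: (hT l).
- by apply: dhomog_prod_const => l _; case: (hT l).
move=> y Uy Wy; have hy j : hval (b j) y != 0 /\ f j y = hval (a j) y / hval (b j) y.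
  by case: (hT j) => _ _ _ _; apply => //; exact: Wy.
split.
  by rewrite /hval rmorph_prod; apply/prodf_neq0 => j _; case: (hy j).
move=> j; rewrite [\prod_l b l](bigD1 j) //= /hval !mevalM -!/(hval _ _).
have [b0 ->] := hy j.
by rewrite mulrAC [hval (b j) y * _]mulrCA divff // mulr1.
Qed.

(** Some coordinate X_j0 is nonzero at [f x]. The functions X_j / X_j0 pull back to regular
    functions, and their numerators over a common denominator are homogeneous coordinates of [f]. *)
Lemma morphism_locally_forms n m (X : set (pspace K n)) (Y : set (pspace K m)) f :
  morphism_on X Y f -> locally_given_by_forms X f.
Proof.
move=> [fXY fcont freg] x Xx.
have /row_neq0P[j0 hj0] := hcoord_neq0 (f x).
pose V := [set y : pspace K m | hval 'X_j0 y != 0].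
have hX (j : 'I_m.+1) : ('X_j : {mpoly K[m.+1]}) \is 1.-homog.
  by rewrite dhomogX /= mdeg1.
have oV : zopen V by exact: zopen_nz (hX j0).
have Vfx : V (f x) by rewrite /V /= /hval mevalXU.
pose g (j : 'I_m.+1) (y : pspace K m) := hval 'X_j y / hval 'X_j0 y.
have greg j : regular_on (Y `&` V) (g j).
  move=> y [Yy Vy]; exists V; split => //; exists 1%N, 'X_j, 'X_j0; split => //.
have [W [a [b [d [oW Wx ha hb hab]]]]] :=
  regular_common_denominator (fun j => freg V (g j) oV (greg j)) (conj Xx Vfx).
(* Continuity makes [f y] in [V] an open condition: y avoids [Z']. *)
have [Z' cZ' EZ'] := fcont (~` V) oV.
exists (W `&` ~` Z'), a, d; split => //.
- by apply: zopenI => //; rewrite /zopen setCK.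
- split=> // Z'x; have : (X `&` Z') x by [].
  by rewrite -EZ' => -[_]; apply.
move=> y Xy [Wy nZ'y].
have Vy : V (f y).
  apply: contrapT => nV; apply: nZ'y.
  have : (X `&` f @^-1` (~` V)) y by [].
  by rewrite EZ' => -[].
have [b0 Ha] := hab y (conj Xy Vy) Wy.
have E : rval a (hcoord y) = (hval b y / hval 'X_j0 (f y)) *: hcoord (f y).
  apply/rowP => j; rewrite !mxE -/(hval _ _) Ha /= /g -mulrA [_ / _]mulrC.
  by rewrite /hval !mevalXU.
have c0 : hval b y / hval 'X_j0 (f y) != 0 by rewrite mulf_neq0 // invr_neq0.
rewrite E scaler_eq0 (negPf c0) (negPf (hcoord_neq0 _)); split => //.
by rewrite proj_pt_scale // proj_pt_hcoord.
Qed.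

Lemma locally_forms_morphism n m (X : set (pspace K n)) (Y : set (pspace K m)) f :
  (forall x, X x -> Y (f x)) -> locally_given_by_forms X f -> morphism_on X Y f.
Proof.
move=> fXY hf; split => //.
  move=> Z cZ; pose A := X `&` f @^-1` Z.
  exists (\bigcap_(C in [set C | zclosed C /\ A `<=` C]) C).
    by apply: zclosed_bigcap => C [].
  apply/seteqP; split => x.
    by move=> Ax; split; [case: Ax|move=> C [_]; apply].
  move=> [Xx Hx]; split => //=.
  have [W [F [d [oW Wx hF hW]]]] := hf x Xx.
  (* This closed set contains [A], hence its closure and x. Since x lies in [W] and [F] does not
     vanish there, [f x] lies in [Z]. *)
  have cC := zclosedU oW (zclosed_comp hF cZ).
  have := Hx _ (conj cC _); case => //.
  - move=> y [Xy Zy]; have [Wy|] := pselect (W y); [right|by left].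
    by right; rewrite -(hW y Xy Wy).2.
  - by have [F0 ->] := hW x Xx Wx; case => // /eqP; rewrite (negPf F0).
move=> V g oV hg x [Xx Vfx].
have [W [F [d [oW Wx hF hW]]]] := hf x Xx.
have [W2 [oW2 W2x [e [a [b [ha hb hab]]]]]] := hg (f x) (conj (fXY x Xx) Vfx).
pose T := [set y | rval F (hcoord y) != 0 /\ W2 (proj_pt (rval F (hcoord y)))].
exists (W `&` T); split.
- by apply: zopenI => //; exact: zopen_comp hF oW2.
- by split => //; have [F0 E] := hW x Xx Wx; split => //; rewrite -E.
exists (e * d)%N, (comp_forms F a), (comp_forms F b); split.
- exact: dhomog_comp_forms.
- exact: dhomog_comp_forms.
move=> y [Xy Vy] [Wy [F0 W2y]].
have [_ E] := hW y Xy Wy.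
have [] := hab (f y) (conj (fXY y Xy) Vy); first by rewrite E.
rewrite /= => b0 ->; move: b0; rewrite E /hval !meval_comp_forms.
(* Numerator and denominator have the same degree e, so the factor c^e cancels. *)
have [c c0 ->] := hcoord_proj_pt F0.
rewrite !(meval_dhomog_scale _ _ ha, meval_dhomog_scale _ _ hb).
rewrite mulf_eq0 negb_or => /andP[ce b0]; split => //.
by rewrite -mulf_div divff // mul1r.
Qed.

End Morphisms.

(** * A local criterion for embeddings *)

Section Embeddings.
Variable K : closedFieldType.

Lemma proj_pt_minors n (v w : 'rV[K]_n.+1) : v != 0 -> w != 0 ->
  (forall i j, v ord0 i * w ord0 j = v ord0 j * w ord0 i) ->
  proj_pt v = proj_pt w.
Proof.
move=> /row_neq0P[i vi] w0 H.
have E : w = (w ord0 i / v ord0 i) *: v.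
  apply/rowP => j; rewrite mxE; apply: (mulfI vi).
  by rewrite H [RHS]mulrA [_ * (_ / _)]mulrC divfK // mulrC.
rewrite E proj_pt_scale //; apply: contra_neq w0 => c0.
by rewrite E c0 scale0r.
Qed.

(** The condition says that F(y) is a multiple of y, that is, that the 2 by 2 minors of the rows y
    and F(y) vanish. *)
Lemma zclosed_fixed n (F : 'I_n.+1 -> {mpoly K[n.+1]}) d :
  (forall j, F j \is d.-homog) ->
  zclosed [set y | rval F (hcoord y) = 0 \/ proj_pt (rval F (hcoord y)) = y].
Proof.
move=> hF; pose f (ij : 'I_n.+1 * 'I_n.+1) := 'X_ij.1 * F ij.2 - 'X_ij.2 * F ij.1.
have -> : [set y | rval F (hcoord y) = 0 \/ proj_pt (rval F (hcoord y)) = y] =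
    \bigcap_(ij in setT) [set y | hval (f ij) y = 0].
  apply/seteqP; split => y /=.
    move=> H [i j] _ /=; rewrite /hval mevalB !mevalM !mevalXU /=.
    suff [c E] : exists c, rval F (hcoord y) = c *: hcoord y.
      have E' l : (F l).@[hcoord y ord0] = c * hcoord y ord0 l.
        by move/rowP/(_ l): E; rewrite !mxE.
      by rewrite !E' mulrCA [X in _ - X]mulrCA [X in c * X]mulrC subrr.
    have [F0|F0] := eqVneq (rval F (hcoord y)) 0.
      by exists 0; rewrite scale0r.
    case: H => [/eqP|]; first by rewrite (negPf F0).
    rewrite -[in RHS](proj_pt_hcoord y) => /(proj_pt_eq F0 (hcoord_neq0 y)).
    by case=> c _ E; exists c.
  move=> H; have [|F0] := eqVneq (rval F (hcoord y)) 0; [by left|right].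
  rewrite -[RHS]proj_pt_hcoord; apply: proj_pt_minors => //.
    exact: hcoord_neq0.
  move=> i j; have := H (j, i) I.
  rewrite /= /hval mevalB !mevalM !mevalXU !mxE /= => /eqP.
  by rewrite subr_eq0 => /eqP; rewrite mulrC => ->; rewrite mulrC.
apply: zclosed_bigcap => -[i j] _; apply: (@zclosed_hyper _ _ _ (1 + d)%N).
by rewrite rpredB //; apply: dhomogM => //; rewrite dhomogX /= mdeg1.
Qed.

(* psi is a closed embedding of M, with inverse G. The forms q recover psi from
   phi, so phi is inverted by G after q; the forms a express phi near x0, and
   phi @` U is cut out near phi x0 by the equations q(y) \in psi @` M and
   a(G(q(y))) = y. *)
Lemma embedding_of_local_factorization n m p (M U : set (pspace K n))
    (phi : pspace K n -> pspace K p) (psi : pspace K n -> pspace K m)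
    (G : pspace K m -> pspace K n) :
  zclosed (psi @` M) -> morphism_on (psi @` M) M G ->
  (forall x, M x -> G (psi x) = x) -> U `<=` M ->
  (forall x0, U x0 ->
    (exists W (q : 'I_m.+1 -> {mpoly K[p.+1]}) d,
      [/\ zopen W, W (phi x0), forall j, q j \is d.-homog &
       forall x, U x -> W (phi x) -> rval q (hcoord (phi x)) != 0 /\
         psi x = proj_pt (rval q (hcoord (phi x)))]) /\
    (exists V (a : 'I_p.+1 -> {mpoly K[n.+1]}) d,
      [/\ zopen V, V x0, forall j, a j \is d.-homog &
       forall x, M x -> V x -> [/\ U x, rval a (hcoord x) != 0 &
         phi x = proj_pt (rval a (hcoord x))]])) ->
  embedding U phi.
Proof.
move=> cpsi mG GK UM loc.
have phiU : locally_given_by_forms U phi.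
  move=> x Ux; have [_ [V [a [d [oV Vx ha hV]]]]] := loc x Ux.
  exists V, a, d; split=> // y Uy Vy.
  by have [_ ? ?] := hV y (UM _ Uy) Vy.
have phi_inj x x' : U x -> U x' -> phi x = phi x' -> x = x'.
  move=> Ux Ux' E; have [[W [q [d [_ Wx _ hW]]]] _] := loc x Ux.
  rewrite -(GK x (UM _ Ux)) -(GK x' (UM _ Ux')).
  by rewrite (hW x Ux Wx).2 E -(hW x' Ux' _).2 // -E.
(* A set-theoretic inverse of [phi], with a junk value off the image; [inv] below provides forms
   that give it locally. *)
have /choice[H HP] : forall y, exists x, (phi @` U) y -> U x /\ phi x = y.
  move=> y; have [[x Ux <-]|ny] := pselect ((phi @` U) y); first by exists x.
  by exists (proj_pt 0).
have HK x : U x -> H (phi x) = x.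
  move=> Ux; have [|UH E] := HP (phi x); first by exists x.
  exact: phi_inj E.
(* The forms [h] are obtained by substituting [q] into forms that give [G] near [psi x0]. The last
   clause covers every y in [W] that [q] sends into the image of [psi], not only the image of [phi];
   cutting out that image relies on this. *)
have inv x0 : U x0 -> exists W (q : 'I_m.+1 -> {mpoly K[p.+1]}) d
    (h : 'I_n.+1 -> {mpoly K[p.+1]}) e,
  [/\ zopen W, W (phi x0), forall j, q j \is d.-homog, forall j, h j \is e.-homog &
   (forall x, U x -> W (phi x) -> rval q (hcoord (phi x)) != 0 /\
      psi x = proj_pt (rval q (hcoord (phi x)))) /\
   forall y, W y -> (psi @` M) (proj_pt (rval q (hcoord y))) ->
     rval h (hcoord y) != 0 /\
     G (proj_pt (rval q (hcoord y))) = proj_pt (rval h (hcoord y))].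
  move=> Ux0; have [[W [q [d [oW Wx hq hW]]]] _] := loc x0 Ux0.
  have psiM x : U x -> (psi @` M) (psi x) by move=> Ux; exists x => //; exact: UM.
  have [W2 [g [e [oW2 W2x hg hW2]]]] := morphism_locally_forms mG (psiM _ Ux0).
  pose T := [set y | rval q (hcoord y) != 0 /\ W2 (proj_pt (rval q (hcoord y)))].
  exists (W `&` T), q, d, (fun j => comp_forms q (g j)), (e * d)%N; split => //.
  - by apply: zopenI => //; exact: zopen_comp hq oW2.
  - by split => //; have [q0 E] := hW x0 Ux0 Wx; split => //; rewrite -E.
  - by move=> j; exact: dhomog_comp_forms.
  split=> [x Ux [Wx' _]|y [_ [q0 W2y]] My]; first exact: hW.
  have := hW2 _ My W2y; rewrite rval_comp; have [c c0 ->] := hcoord_proj_pt q0.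
  rewrite (rval_scale _ _ hg) scaler_eq0 negb_or => -[/andP[ce g0] ->].
  by rewrite proj_pt_scale.
split; last first.
  split; first by apply: locally_forms_morphism => // x Ux; exists x.
  exists H; split=> //; last by move=> y /HP[].
  apply: locally_forms_morphism; first by move=> y /HP[].
  move=> _ [x0 Ux0 <-].
  have [W [q [d [h [e [oW Wx hq hh [h1 h2]]]]]]] := inv x0 Ux0.
  exists W, h, e; split => // _ [x Ux <-] Wphi.
  have [q0 E] := h1 x Ux Wphi.
  have [|h0 <-] := h2 _ Wphi; first by rewrite -E; exists x => //; exact: UM.
  by split => //; rewrite -E GK ?HK //; exact: UM.
apply: locally_closed_local => _ [x0 Ux0 <-].
have [W [q [d [h [e [oW Wx hq hh [h1 h2]]]]]]] := inv x0 Ux0.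
have [_ [V [a [f [oV Vx ha hV]]]]] := loc x0 Ux0.
(* [A] represents [phi] after [G] after [q], a map near [phi x0] in the target that fixes the image
   of [phi]. *)
pose A j := comp_forms h (a j).
have hA j : A j \is (f * e)%N.-homog by exact: dhomog_comp_forms.
have hinv x : U x -> W (phi x) -> [/\ rval q (hcoord (phi x)) != 0,
    (psi @` M) (proj_pt (rval q (hcoord (phi x)))),
    rval h (hcoord (phi x)) != 0 & proj_pt (rval h (hcoord (phi x))) = x].
  move=> Ux Wphi; have [q0 E] := h1 x Ux Wphi.
  have Mq : (psi @` M) (proj_pt (rval q (hcoord (phi x)))).
    by rewrite -E; exists x => //; exact: UM.
  by have [h0 Eh] := h2 _ Wphi Mq; split => //; rewrite -Eh -E GK //; exact: UM.
have phiA y : rval h (hcoord y) != 0 -> M (proj_pt (rval h (hcoord y))) ->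
    V (proj_pt (rval h (hcoord y))) -> [/\ U (proj_pt (rval h (hcoord y))),
      rval A (hcoord y) != 0 &
      phi (proj_pt (rval h (hcoord y))) = proj_pt (rval A (hcoord y))].
  move=> h0 Mx Vx'; have := hV _ Mx Vx'.
  rewrite rval_comp; have [c c0 ->] := hcoord_proj_pt h0.
  rewrite (rval_scale _ _ ha) scaler_eq0 negb_or => -[Ux /andP[cf A0] ->].
  by rewrite proj_pt_scale.
exists ([set y | rval q (hcoord y) = 0 \/
                 (psi @` M) (proj_pt (rval q (hcoord y)))] `&`
        [set y | rval A (hcoord y) = 0 \/ proj_pt (rval A (hcoord y)) = y]).
(* Removing the zeros of [q] and [h] excludes the degenerate alternatives in the closed conditions,
   and [V] forces G(q(y)) to lie in [U]. *)
exists (W `&` ([set y | rval h (hcoord y) != 0 /\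
                        V (proj_pt (rval h (hcoord y)))] `&`
               [set y | rval q (hcoord y) != 0])).
split.
- by apply: zclosedI; [exact: zclosed_comp hq cpsi|exact: zclosed_fixed hA].
- apply: zopenI => //; apply: zopenI; [exact: zopen_comp hh oV|exact: zopen_rval hq].
- have [q0 Mq h0 Eh] := hinv x0 Ux0 Wx.
  by split => //; split => //; split => //; rewrite Eh.
split.
  move=> y [[hq0 hA0] [Wy [[h0 Vy] q0]]].
  case: hq0 => [/eqP|Mq]; first by rewrite (negPf q0).
  have [_ EG] := h2 y Wy Mq.
  have Mx : M (proj_pt (rval h (hcoord y))).
    by rewrite -EG; case: mG => + _ _; apply.
  have [Ux A0 Ephi] := phiA y h0 Mx Vy.
  case: hA0 => [/eqP|EA]; first by rewrite (negPf A0).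
  by exists (proj_pt (rval h (hcoord y))) => //; rewrite Ephi.
move=> _ [[x Ux <-] [Wy [[h0 Vy] q0]]]; have [_ Mq _ Eh] := hinv x Ux Wy.
split; right => //.
have [||_ A0 <-] := phiA _ h0; rewrite Eh //; first exact: UM.
by rewrite -[X in V X]Eh.
Qed.

End Embeddings.

(** * Sections of powers of [L] as forms *)

Section Sections.
Variables (K : closedFieldType) (n : nat) (X : set (pspace K n)).

Lemma regular_onM (U : set (pspace K n)) f g :
  regular_on U f -> regular_on U g -> regular_on U (fun x => f x * g x).
Proof.
move=> hf hg x Ux; have [V [oV Vx [d [a [b [ha hb hab]]]]]] := hf x Ux.
have [W [oW Wx [e [a' [b' [ha' hb' hab']]]]]] := hg x Ux.
exists (V `&` W); split => //; first exact: zopenI.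
exists (d + e)%N, (a * a'), (b * b'); split; [exact: dhomogM|exact: dhomogM|].
move=> y Uy [Vy Wy]; have [b0 ->] := hab y Uy Vy; have [b0' ->] := hab' y Uy Wy.
by rewrite /hval !mevalM mulf_neq0 // mulf_div.
Qed.

Lemma H0_exp (L : line_bundle X) (t : lsec L) k :
  H0 L t -> H0 (lb_pow L k) (fun i x => t i x ^+ k).
Proof.
move=> [tr tc]; split => [i|i j x Ui Uj /=]; last by rewrite (tc i j) // exprMn.
move=> x Ux; have [W [oW Wx [d [a [b [ha hb hab]]]]]] := tr i x Ux.
exists W; split => //; exists (d * k)%N, (a ^+ k), (b ^+ k).
split; [exact: dhomogMn|exact: dhomogMn|] => y Uy Wy.
have [b0 ->] := hab y Uy Wy.
by rewrite /hval !rmorphXn /= expf_neq0 // expr_div_n.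
Qed.

Lemma H0_mul (L : line_bundle X) d e (u : lsec (lb_pow L d)) (v : lsec (lb_pow L e)) :
  H0 (lb_pow L d) u -> H0 (lb_pow L e) v ->
  H0 (lb_pow L (d + e)) (fun i x => u i x * v i x).
Proof.
move=> [ur uc] [vr vc]; split => [i|i j x Ui Uj /=].
  exact: regular_onM (ur i) (vr i).
by rewrite (uc i j) // (vc i j) //= exprD mulrACA.
Qed.

(** A change of trivialization multiplies all coordinates by the same nonzero transition value. *)
Lemma lsec_mapE (L : line_bundle X) N (s : 'I_N.+1 -> lsec L) i x :
  (forall j, H0 L (s j)) -> lb_U i x -> lsec_map s x = proj_pt (\row_j s j i x).
Proof.
move=> hs Ui; rewrite /lsec_map; case: pselect => [e|]; last by case; exists i.
set i' := sval _; have Ui' : lb_U i' x by exact: svalP (cid e).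
have -> : \row_j s j i' x = lb_g i' i x *: \row_j s j i x.
  by apply/rowP => j; rewrite !mxE; case: (hs j) => _; apply.
by rewrite proj_pt_scale //; exact: lb_neq0.
Qed.

(** The forms are numerators over a common denominator, whose value is the factor [c]. *)
Lemma sections_local_forms (L : line_bundle X) m (s : 'I_m -> lsec L) i x :
  (forall j, H0 L (s j)) -> lb_U i x ->
  exists W (a : 'I_m -> {mpoly K[n.+1]}) d,
  [/\ zopen W, W x, forall j, a j \is d.-homog &
    forall y, X y -> W y -> lb_U i y /\
      exists2 c, c != 0 & rval a (hcoord y) = c *: \row_j s j i y].
Proof.
move=> hs Ui.
have [W [a [b [d [oW Wx ha hb hab]]]]] :=
  regular_common_denominator (fun j => (hs j).1 i) Ui.
have [W' oW' EU] := lb_open i.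
exists (W `&` W'), a, d; split => //; first exact: zopenI.
  by split => //; move: Ui; rewrite EU => -[].
move=> y Xy [Wy W'y]; have Uy : lb_U i y by rewrite EU.
have [b0 H] := hab y Uy Wy.
by split => //; exists (hval b y) => //; apply/rowP => j; rewrite !mxE -H.
Qed.

Lemma section_neq0_open (L : line_bundle X) (t : lsec L) i x :
  H0 L t -> lb_U i x -> t i x != 0 ->
  exists W, [/\ zopen W, W x & forall y, X y -> W y -> lb_U i y /\ t i y != 0].
Proof.
move=> ht Ui t0.
have [W [a [d [oW Wx ha hW]]]] :=
  sections_local_forms (s := fun _ : 'I_1 => t) (fun _ => ht) Ui.
have aE y : X y -> W y -> lb_U i y /\ (rval a (hcoord y) != 0) = (t i y != 0).
  move=> Xy Wy; have [Uy [c c0 ->]] := hW y Xy Wy; split => //.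
  rewrite scaler_eq0 (negPf c0) /=; apply/idP/idP.
    by move=> /row_neq0P[j]; rewrite mxE.
  by move=> ty; apply/row_neq0P; exists ord0; rewrite mxE.
exists (W `&` [set y | rval a (hcoord y) != 0]); split.
- by apply: zopenI => //; exact: zopen_rval ha.
- split => //=; rewrite (aE x _ Wx).2 //.
  by have [W' _ EU] := lb_open i; move: Ui; rewrite EU => -[].
- by move=> y Xy [Wy]; have [? /= ->] := aE y Xy Wy.
Qed.

(** The coefficients of [t] in the basis are constants, so one linear form serves all
    trivializations. *)
Lemma basis_linear_form (L : line_bundle X) N (s : 'I_N -> lsec L) t :
  lsec_basis s -> H0 L t -> exists2 f : {mpoly K[N]}, f \is 1.-homog &
    forall i x, lb_U i x -> f.@[(\row_j s j i x) ord0] = t i x.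
Proof.
move=> [_ _ span] /span[c Ec]; exists (\sum_j c j *: 'X_j).
  by rewrite rpred_sum // => j _; apply: dhomogZ; rewrite dhomogX /= mdeg1.
move=> i x Ui; rewrite Ec // raddf_sum; apply: eq_bigr => j _.
by rewrite /= mevalZ mevalXU mxE.
Qed.

(* A factor u in H^0(dL) of a monomial is turned into a section of rL by
   multiplying it by t^(r - d), and the number e <= k of factors into k by
   multiplying by t^(r(k - e)); the total power of t is (r - 1)k. *)
Lemma r_generated_form (L : line_bundle X) r k N (s : 'I_N -> lsec (lb_pow L r))
    (t : lsec L) (v : lsec (lb_pow L k)) :
  (0 < r)%N -> r_generated r L -> lsec_basis s -> H0 L t -> (0 < k)%N ->
  H0 (lb_pow L k) v ->
  exists2 q : {mpoly K[N]}, q \is k.-homog &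
    forall i x, lb_U i x ->
      q.@[(\row_j s j i x) ord0] = t i x ^+ (r.-1 * k) * v i x.
Proof.
move=> r0 gen hs ht k0 hv.
have [m [c [e [d [u [hu hd Ev]]]]]] := gen k v k0 hv.
have [ell hell ellE] := basis_linear_form hs (H0_exp r ht).
(* The section u t^(r-d) of rL is a linear form in the basis; indices beyond the number of factors
   get the dummy value 0. *)
have /choice[lam hlam] : forall ab : 'I_m * nat, exists f : {mpoly K[N]},
    (ab.2 < e ab.1)%N -> f \is 1.-homog /\
    forall i x, lb_U i x -> f.@[(\row_j s j i x) ord0] =
      u ab.1 ab.2 i x * t i x ^+ (r - d ab.1 ab.2).
  move=> [a b]; have [lt_b|] := ltnP b (e a); last by exists 0.
  have [/andP[d1 dr] hab] := hu a b lt_b.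
  have := H0_mul hab (H0_exp (r - d a b) ht); rewrite subnKC // => h.
  have [f hf fE] := basis_linear_form hs h.
  by exists f.
(* Every factor has degree at least 1, and the degrees add up to k. *)
have lee a : (e a <= k)%N.
  apply: (@leq_trans (\sum_(b < e a) 1)%N); first by rewrite sum1_card card_ord.
  rewrite -(hd a); apply: leq_sum => b _.
  by have [/andP[]] := hu a b (ltn_ord b).
exists (\sum_(a < m) c a *: (ell ^+ (k - e a) * \prod_(b < e a) lam (a, nat_of_ord b))).
  rewrite rpred_sum // => a _; apply: dhomogZ.
  have Ek : (1 * (k - e a) + \sum_(b < e a) 1 = k)%N.
    by rewrite sum1_card card_ord mul1n subnK.
  rewrite -[X in _ \is X.-homog]Ek; apply: dhomogM; first exact: dhomogMn.
  by apply: dhomog_prod_const => b _; case: (hlam (a, nat_of_ord b)) => /=.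
move=> i x Ui; rewrite Ev // raddf_sum mulr_sumr; apply: eq_bigr => a _.
rewrite /= mevalZ mevalM rmorphXn rmorph_prod /= ellE // [RHS]mulrCA; congr (_ * _).
rewrite (eq_bigr (fun b : 'I_(e a) => u a b i x * t i x ^+ (r - d a b))); last first.
  by move=> b _; case: (hlam (a, nat_of_ord b)) => //= _; apply.
rewrite big_split /= mulrCA mulrC; congr (_ * _).
rewrite prodrXr -exprM -exprD; congr (_ ^+ _).
(* Adding k to the exponents avoids truncated subtraction: r(k-e) + re = rk = (r-1)k + k. *)
have E : (\sum_(b < e a) (r - d a b) + k = r * e a)%N.
  rewrite -[X in (_ + X)%N](hd a) -big_split /=.
  rewrite (eq_bigr (fun=> r)) => [|b _]; first by rewrite sum_nat_const card_ord mulnC.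
  by rewrite subnK //; have [/andP[]] := hu a b (ltn_ord b).
apply/eqP; rewrite -(eqn_add2r k) -addnA E -mulnDr subnK //.
by rewrite -{1}(prednK r0) mulSn addnC.
Qed.

End Sections.

(** * The map of |rL| outside the base locus of |L| *)

Theorem theorem2p2 (R : realType) (n : nat) (M : set (pspace R[i] n))
    (L : line_bundle M) (r : nat)
    (hML : polarized_manifold L) (hr : (1 <= r)%N)
    (heff : effective L) (hgen : r_generated r L)
    (N : nat) (s : 'I_N.+1 -> lsec (lb_pow L r))
    (hs : lsec_basis s) :
  lsec_map_embeds s (M `\` base_locus L).
Proof.
have [_ _ [k k0 [m [t [ht tnz [cpsi [_ [G [mG GK _]]]]]]]]] := hML.
have hs0 j : H0 (lb_pow L r) (s j) by case: hs.
have nbs x : (M `\` base_locus L) x -> exists tau i,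
    [/\ H0 L tau, lb_U i x & tau i x != 0].
  move=> [Mx nB]; apply: contrapT => nex; apply: nB; split=> // tau htau i Ui.
  by apply/eqP/negPn/negP => tau0; apply: nex; exists tau, i.
(* The power tau^r is a linear form in the [s j], so it would vanish together with them. *)
have row_nz tau i x : H0 L tau -> lb_U i x -> tau i x != 0 ->
    \row_j s j i x != 0.
  move=> htau Ui; apply: contra_neq => s0.
  have [f hf fE] := basis_linear_form hs (H0_exp r htau).
  have := fE i x Ui; rewrite s0 -(scale0r 0) (meval_dhomog_scale _ _ hf).
  by rewrite expr1 mul0r => /esym/eqP; rewrite expf_eq0 => /andP[_ /eqP].
have nz : no_common_zero s (M `\` base_locus L).
  move=> x i /nbs[tau [i' [htau Ui' tau0]]] Ui.
  have tau0' : tau i x != 0.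
    by case: htau => _ /(_ i i' x Ui Ui') ->; rewrite mulf_neq0 // lb_neq0.
  by have /row_neq0P[j] := row_nz _ _ _ htau Ui tau0'; rewrite mxE; exists j.
split=> //; apply: (embedding_of_local_factorization cpsi mG) => //.
move=> x0 Ux0; have [tau [i0 [htau Ui0 tau0]]] := nbs x0 Ux0.
split; last first.
  (* Near [x0] the map is given by the numerators of the [s j]. Shrinking to where [tau] is nonzero
     keeps all points of [M] there off the base locus. *)
  have [V [a [d [oV Vx ha hV]]]] := sections_local_forms hs0 Ui0.
  have [W [oW Wx hW]] := section_neq0_open htau Ui0 tau0.
  exists (V `&` W), a, d; split=> //; first exact: zopenI.
  move=> x Mx [Vx' Wx']; have [Ui [c c0 Ea]] := hV x Mx Vx'.
  have [_ taux] := hW x Mx Wx'.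
  rewrite Ea scaler_eq0 (negPf c0) (negPf (row_nz _ _ _ htau Ui taux)).
  rewrite proj_pt_scale // (lsec_mapE hs0 Ui); split => //; split => //.
  by move=> [_ /(_ tau htau i0 Ui)] /eqP; exact/negP.
have [ell hell ellE] := basis_linear_form hs (H0_exp r htau).
(* The factor tau^((r-1)k) is common to all j, so where [tau] is nonzero the [q j] define the same
   point as the [t j]. *)
have /choice[q hq] : forall j, exists q : {mpoly R[i][N.+1]}, q \is k.-homog /\
    forall i x, lb_U i x ->
      q.@[(\row_j s j i x) ord0] = tau i x ^+ (r.-1 * k) * t j i x.
  move=> j; have [q hq qE] := r_generated_form hr hgen hs htau k0 (ht j).
  by exists q.
have map_coord x i : (M `\` base_locus L) x -> lb_U i x ->
    exists2 c, c != 0 & hcoord (lsec_map s x) = c *: \row_j s j i x.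
  move=> Ux Ui; rewrite (lsec_mapE hs0 Ui); apply: hcoord_proj_pt.
  by have [j sj] := nz x i Ux Ui; apply/row_neq0P; exists j; rewrite mxE.
(* [ell] represents tau^r with r positive, so the complement of its hyperplane pulls back to the
   locus where [tau] is nonzero. *)
have ell_nz x i : (M `\` base_locus L) x -> lb_U i x ->
    (hval ell (lsec_map s x) != 0) = (tau i x != 0).
  move=> Ux Ui; have [c c0 E] := map_coord x i Ux Ui.
  rewrite /hval E (meval_dhomog_scale _ _ hell) expr1 ellE // mulf_eq0.
  by rewrite (negPf c0) expf_eq0 hr.
exists [set y | hval ell y != 0], q, k; split.
- exact: zopen_nz hell.
- by rewrite /= (ell_nz x0 i0).
- by move=> j; case: (hq j).
move=> x Ux /=.
have [i Ui] := lb_cover L Ux.1.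
rewrite (ell_nz x i) // => taux.
have [c c0 ->] := map_coord x i Ux Ui.
rewrite (rval_scale _ _ (fun j => (hq j).1)).
have -> : rval q (\row_j s j i x) = tau i x ^+ (r.-1 * k) *: \row_j t j i x.
  by apply/rowP => j; rewrite !mxE; case: (hq j) => _ ->.
rewrite scalerA; set a := _ * _.
have a0 : a != 0 by rewrite mulf_neq0 // expf_neq0.
rewrite scaler_eq0 (negPf a0) proj_pt_scale // (lsec_mapE ht Ui); split => //.
have [j tj] := tnz x i Ux.1 Ui.
by apply/row_neq0P; exists j; rewrite mxE.
Qed.
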